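(* Let $\Omega\subset\mathbb{R}^N$ be a region and let $H_N$ be the Neumann Laplacian on $\Omega$. Suppose that $H_N$ has discrete spectrum with non-negative eigenvalues $\lambda_n$ ($n\ge0$) of finite multiplicity, written in increasing order and repeated according to multiplicity, and let $f_n$ denote the corresponding orthonormal basis of eigenfunctions. Suppose there are constants $c_6,c_7,c_8,c_9>0$, an integer $n_0>c_7^{-1}$ and $\alpha>1$ such that $$\lambda_n\ge c_6\left(\log(c_7n)\right)^\alpha\quad\text{for all } n\ge n_0,$$ $$\|f_n\|_\infty\le c_8 \ \text{ for } 0\le n<n_0,\qquad \|f_n\|_\infty\le c_8\exp\left(c_9\lambda_n^{1/\alpha}\right)\ \text{ for } n\ge n_0.$$ Then there exist constants $C_3,C_4>0$, depending only on $c_6,c_7,c_8,c_9,n_0$ and $\alpha$, such that $$\|e^{-H_Nt}f\|_\infty\le C_3\exp\left(C_4t^{-1/(\alpha-1)}\right)\|f\|_2$$ for all $f\in L^2(\Omega)$ and $0<t\le1$.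
   Context: A region is a nonempty connected open set. $H_N$ is the non-negative self-adjoint operator in $L^2(\Omega)$ associated with the closed quadratic form $Q(f)=\int_\Omega|\nabla f|^2\,d^Nx$ if $f\in W^{1,2}(\Omega)$ and $Q(f)=+\infty$ otherwise. $e^{-H_Nt}$ is the associated symmetric Markov semigroup. $\|\cdot\|_p$ is the norm of $L^p(\Omega)$. *)

(* Defs.v *)
From HB Require Import structures.
From mathcomp Require Import all_boot all_order all_algebra.
From mathcomp Require Import all_classical all_reals all_analysis.
From mathcomp Require Import complex.

Set Implicit Arguments.
Unset Strict Implicit.
Unset Printing Implicit Defensive.

Import Order.TTheory GRing.Theory Num.Theory.
Import numFieldNormedType.Exports.

Local Open Scope classical_set_scope.
Local Open Scope ring_scope.
Local Open Scope complex_scope.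

Notation borel_rV R N := (g_sigma_algebraType (@open 'rV[R]_N)).

Definition pushforward_measure d d' (T1 : measurableType d)
    (T2 : measurableType d') (R : realType) (m : {measure set T1 -> \bar R})
    (f : T1 -> T2) (mf : measurable_fun [set: T1] f)
    : {measure set T2 -> \bar R} :=
  measure_function_pushforward__canonical__measure_function_Measure m mf.

Section lebesgue_rV.
Variable R : realType.
Implicit Type N : nat.

Definition rV_of_tuple N (t : N.-tuple (measurableTypeR R)) : borel_rV R N :=
  \row_i (tnth t i : R).

(* an open set of R^N is a countable union of boxes with rational data *)
Lemma measurable_rV_of_tuple N : measurable_fun [set: _] (@rV_of_tuple N).
Proof.
apply: (@measurability _ _ _ (borel_rV R N) _ _ (@open (matrix R 1 N))) => //.
move=> _ [U oU <-]; rewrite setTI.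
pose I := ({ffun 'I_N -> rat} * nat)%type.
pose bx (p : I) := [set v : 'rV[R]_N |
  forall i, ball (ratr (p.1 i) : R) (p.2.+1%:R^-1) (v ord0 i)].
pose F (p : I) := if `[< bx p `<=` U >]
  then @rV_of_tuple N @^-1` bx p else set0.
have -> : @rV_of_tuple N @^-1` U = \bigcup_p F p.
  apply/seteqP; split => [t /= Ut|t [p _]]; last first.
    by rewrite /F; case: asboolP => // sub; exact: sub.
  have : nbhs (rV_of_tuple t : 'rV[R]_N) U by exact: open_nbhs_nbhs.
  move=> /nbhs_ballP[e /= e0 eU].
  have [k ke] : exists k : nat, (k.+1%:R^-1 + k.+1%:R^-1 < e)%R.
    exists (Num.truncn ((1 + 1) / e)).
    rewrite -[X in X + X]div1r -mulrDl ltr_pdivrMr// mulrC -ltr_pdivrMr//.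
    exact: Num.Theory.truncnS_gt.
  have rk0 : (0 < k.+1%:R^-1 :> R)%R by rewrite invr_gt0.
  have /choice[q qP] : forall i : 'I_N, exists q : rat,
      ball (ratr q : R) (k.+1%:R^-1) (tnth t i : R).
    move=> i; have tlt : (tnth t i : R) < (tnth t i : R) + k.+1%:R^-1.
      by rewrite ltrDl.
    have [q] := rat_in_itvoo tlt; rewrite in_itv/= => /andP[q1 q2].
    exists q; rewrite /ball/= ltr_distlC; apply/andP; split.
      by rewrite ltrBlDr.
    by rewrite (lt_trans q1)// ltrDl.
  exists ([ffun i => q i], k) => //; rewrite /F ifT; last first.
    apply/asboolP => v /= vb; apply: eU; split=> // i j.
    rewrite !ord1 /rV_of_tuple mxE; apply: (le_ball (ltW ke)).
    have := vb j; rewrite ffunE => vbj.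
    exact: ball_triangle (ball_sym (qP j)) vbj.
  by move=> i /=; rewrite ffunE mxE.
apply: countable_bigcupT_measurable; first exact: countableP.
move=> p; rewrite /F; case: ifPn => // _.
have -> : @rV_of_tuple N @^-1` bx p =
    \bigcap_i ((fun t : N.-tuple (measurableTypeR R) => tnth t i) @^-1`
      (ball (ratr (p.1 i) : R) (p.2.+1%:R^-1))).
  apply/seteqP; split => t /= tb i; first by have := tb i; rewrite mxE.
  by rewrite mxE; exact: tb.
apply: fin_bigcap_measurable => // i _; rewrite -[X in measurable X]setTI.
apply: measurable_tnth => //.
by rewrite ball_itv; exact: measurable_itv.
Qed.

Definition tuple_cons N (p : N.-tuple (measurableTypeR R) * measurableTypeR R)
    : N.+1.-tuple (measurableTypeR R) := [the N.+1.-tuple _ of p.2 :: p.1].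

Lemma measurable_tuple_cons N : measurable_fun [set: _] (@tuple_cons N).
Proof. exact: measurable_cons. Qed.

Fixpoint lebesgue_tuple N
    : {measure set (N.-tuple (measurableTypeR R)) -> \bar R} :=
  match N with
  | 0 => \d_ [tuple]
  | M.+1 => pushforward_measure (lebesgue_tuple M \x (@lebesgue_measure R))%E
              (@measurable_tuple_cons M)
  end.

Lemma lebesgue_tuple_box N (A : 'I_N -> set (measurableTypeR R)) :
  (forall i, measurable (A i)) ->
  lebesgue_tuple N [set t | forall i, A i (tnth t i)] =
  (\prod_(i < N) lebesgue_measure (A i))%E.
Proof.
elim: N A => [|N IH] A mA.
  by rewrite big_ord0 /= diracE mem_set// => -[].
rewrite big_ord_recl muleC -IH => [|i]; last exact: mA.
rewrite /= /pushforward -product_measure1E//; last first.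
  rewrite [X in measurable X](_ : _ = \bigcap_i
      ((fun t : N.-tuple (measurableTypeR R) => tnth t i) @^-1`
        A (lift ord0 i))); last first.
    by apply/seteqP; split=> t /= tA i => [_|]; exact: tA.
  apply: fin_bigcap_measurable => // i _; rewrite -[X in measurable X]setTI.
  by apply: measurable_tnth => //; exact: mA.
congr product_measure1; apply/seteqP; split => -[t x] /=.
  move=> tA; split => [i|]; last by have := tA ord0.
  by have := tA (lift ord0 i); rewrite tnthS.
move=> [tA xA] i; case: (unliftP ord0 i) => [j|] ->//.
by rewrite tnthS; exact: tA.
Qed.

Definition lebesgue_rV N : {measure set (borel_rV R N) -> \bar R} :=
  pushforward_measure (lebesgue_tuple N) (@measurable_rV_of_tuple N).

End lebesgue_rV.

Lemma open_measurable_rV (R : realType) N (U : set 'rV[R]_N) :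
  open U -> measurable (U : set (borel_rV R N)).
Proof. exact: sub_sigma_algebra. Qed.

(* Lebesgue measure on [Omega], extended by zero to R^N: with this measure,
   L^p norms and almost everywhere statements only see [Omega]. *)
Definition volume (R : realType) N (Omega : set 'rV[R]_N) (oO : open Omega)
    : {measure set (borel_rV R N) -> \bar R} :=
  mrestr (lebesgue_rV R N) (open_measurable_rV oO).

(* Elements of L^p are represented by functions; equality in L^p is equality
   almost everywhere. *)
Section complex_Lp.
Context d (T : measurableType d) (R : realType).
Variable mu : {measure set T -> \bar R}.
Implicit Types (p : \bar R) (f g : T -> R[i]).

Definition CLfun p : set (T -> R[i]) :=
  [set f | (fun x => complex.Re (f x)) \in Lfun mu p /\
           (fun x => complex.Im (f x)) \in Lfun mu p].

(* [`|z|] lives in [R[i]] *)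
Definition cabs (z : R[i]) : R := complex.Re `|z|.

Definition CLnorm p f : \bar R := 'N[mu]_p[EFin \o cabs \o f]%E.

Definition CRintegral f : R[i] :=
  (\int[mu]_x complex.Re (f x))%R +i* (\int[mu]_x complex.Im (f x))%R.

Definition inner f g : R[i] := CRintegral (fun x => f x * (g x)^*%C).

Definition CL2_cvg (I : Type) (F : set_system I) (u : I -> T -> R[i]) f :=
  CLnorm 2 (fun x => u i x - f x) @[i --> F] --> 0%E.

Definition orthonormal_basis (e : nat -> T -> R[i]) :=
  [/\ forall n, CLfun 2 (e n),
      forall m n, inner (e m) (e n) = (m == n)%:R &
      forall f, CLfun 2 f ->
        CL2_cvg \oo (fun n x => \sum_(k < n) inner f (e k) * e k x) f].

End complex_Lp.

(* An operator is given by its graph: [H u h] means that [u] belongs to the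
   domain of [H] and that [H u = h]. *)
Definition eigenvector (R : realType) (T : Type)
    (H : (T -> R[i]) -> (T -> R[i]) -> Prop) (z : R[i]) (u : T -> R[i]) :=
  H u (fun x => z * u x).

Section operators.
Context d (T : measurableType d) (R : realType).
Variable mu : {measure set T -> \bar R}.
Variable H : (T -> R[i]) -> (T -> R[i]) -> Prop.

Definition resolvent_set : set R[i] := [set z | exists C : R,
  forall g, CLfun mu 2 g -> exists u h,
    [/\ H u h,
        (fun x => h x - z * u x) = g %[ae mu],
        (CLnorm mu 2 u <= C%:E * CLnorm mu 2 g)%E &
        forall u' h', H u' h' -> (fun x => h' x - z * u' x) = g %[ae mu] ->
          u' = u %[ae mu]]].

Definition spectrum : set R[i] := ~` resolvent_set.

Definition discrete_spectrum := forall z, spectrum z ->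
  [/\ exists2 e : R, 0 < e &
        forall w, spectrum w -> w != z -> e <= cabs (w - z),
      exists2 u, eigenvector H z u & ~ u = (fun=> 0) %[ae mu] &
      exists n (b : 'I_n -> T -> R[i]), forall u, eigenvector H z u ->
        exists c : 'I_n -> R[i],
          u = (fun x => \sum_(i < n) c i * b i x) %[ae mu]].

(* [S t = e^{-Ht}] for [t >= 0], with [H] self-adjoint and non-negative: the
   strongly continuous contraction semigroup on L^2 with generator [-H]. *)
Record is_semigroup (S : R -> (T -> R[i]) -> T -> R[i]) : Prop := IsSemigroup {
  semigroup_CLfun : forall (t : R) f, 0 <= t -> CLfun mu 2 f -> CLfun mu 2 (S t f);
  semigroup_linear : forall (t : R) (a : R[i]) f g, 0 <= t ->
    CLfun mu 2 f -> CLfun mu 2 g ->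
    S t (fun x => a * f x + g x) = (fun x => a * S t f x + S t g x) %[ae mu];
  semigroup_contraction : forall (t : R) f, 0 <= t -> CLfun mu 2 f ->
    (CLnorm mu 2 (S t f) <= CLnorm mu 2 f)%E;
  semigroup_0 : forall f, CLfun mu 2 f -> S 0 f = f %[ae mu];
  semigroup_D : forall (s t : R) f, 0 <= s -> 0 <= t -> CLfun mu 2 f ->
    S (s + t) f = S s (S t f) %[ae mu];
  semigroup_continuous : forall f, CLfun mu 2 f ->
    CL2_cvg mu 0^'+ (S ^~ f) f;
  semigroup_generator : forall f h, CLfun mu 2 f -> CLfun mu 2 h ->
    H f h <->
    CL2_cvg mu 0^'+ (fun t x => (t^-1)%:C * (f x - S t f x)) h }.

End operators.

Section neumann.
Variables (R : realType) (N : nat).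
Local Notation E := 'rV[R]_N.

Definition region (Omega : set E) :=
  [/\ Omega !=set0, connected Omega & open Omega].

Lemma region_open (Omega : set E) : region Omega -> open Omega.
Proof. by case. Qed.

Definition partial (i : 'I_N) (phi : E -> R) : E -> R :=
  fun x => 'D_(delta_mx ord0 i) phi x.

Definition iter_partial (s : seq 'I_N) (phi : E -> R) : E -> R :=
  foldr partial phi s.

Definition smooth (phi : E -> R) := forall s : seq 'I_N,
  continuous (iter_partial s phi) /\
  forall i x, derivable (iter_partial s phi) x (delta_mx ord0 i).

Definition support_in (Omega : set E) (phi : E -> R) :=
  compact (closure [set x | phi x != 0]) /\
  closure [set x | phi x != 0] `<=` Omega.

Variables (Omega : set E) (oO : open Omega).
Local Notation vol := (volume oO).

Definition weak_partial (i : 'I_N) (f g : E -> R[i]) :=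
  forall phi, smooth phi -> support_in Omega phi ->
    CRintegral vol (fun x => f x * (partial i phi x)%:C) =
    - CRintegral vol (fun x => g x * (phi x)%:C).

(* [f] belongs to [W^{1,2}(Omega)] and [df] is its weak gradient *)
Definition W12 (f : E -> R[i]) (df : 'I_N -> E -> R[i]) :=
  CLfun vol 2 f /\ forall i, CLfun vol 2 (df i) /\ weak_partial i f (df i).

(* The self-adjoint operator associated with the closed form
   [Q(f, g) = \int_Omega \nabla f . conj (\nabla g)] on [W^{1,2}(Omega)], the
   polarization of [\int_Omega |\nabla f|^2]: [H_N f = h] when [f] is in
   [W^{1,2}(Omega)] and [Q(f, g) = (h, g)] for all [g] in [W^{1,2}(Omega)]. *)
Definition neumann_laplacian (f h : E -> R[i]) :=
  CLfun vol 2 h /\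
  exists2 df, W12 f df &
    forall g dg, W12 g dg ->
      \sum_(i < N) inner vol (df i) (dg i) = inner vol h g.

End neumann.

(* Main.v *)
(* With g = \sum_k (g, f_k) f_k one has
   e^{-Ht} g = \sum_k e^{- l_k t} (g, f_k) f_k, hence
   ||e^{-Ht} g||_oo <= 2 ||g||_2 \sum_k e^{- l_k t} ||f_k||_oo
   (the 2 bounds real and imaginary parts of (g, f_k) separately).
   Everything then rests on the inequality
     a y - b y^alpha <= a (a / b)^{1 / (alpha - 1)}   (y >= 0),
   used twice: with y = l_k^{1 / alpha} to absorb the growth of ||f_k||_oo in
   half of l_k t, and with y = log (c7 k) to bound the other half of e^{- l_k t}
   by (c7 k)^{-2}; each use costs a factor exp (C t^{-1 / (alpha - 1)}).
   That the f_k are eigenfunctions of e^{-Ht} comes from the contraction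
   property: ||S_{ms} f - e^{- l m s} f|| <= m ||S_s f - e^{- l s} f||, and the
   right-hand side with s = t / m tends to 0 as m grows. *)
Require Import Defs.
From HB Require Import structures.
From mathcomp Require Import all_boot all_order all_algebra.
From mathcomp Require Import all_classical all_reals all_analysis.
From mathcomp Require Import complex measurable_realfun ess_sup_inf.
From mathcomp Require Import ring lra zify.

Set Implicit Arguments.
Unset Strict Implicit.
Unset Printing Implicit Defensive.

Import Order.TTheory GRing.Theory Num.Theory.
Import numFieldNormedType.Exports.

Local Open Scope classical_set_scope.
Local Open Scope ring_scope.
Local Open Scope complex_scope.

(** * Elementary real inequalities *)

Section scalar_estimates.
Variable R : realType.
Implicit Types (a b c t x y alpha : R) (n : nat).

(** Compare y^(alpha - 1) with a / b. If it is smaller, drop the negative term and bound y by taking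
    a root; otherwise b y^alpha exceeds a y and the left side is at most 0. *)
Lemma linear_sub_powR_le a b alpha y : 0 < a -> 0 < b -> 0 <= y -> 1 < alpha ->
  a * y - b * y `^ alpha <= a * (a / b) `^ (alpha - 1)^-1.
Proof.
move=> a0 b0 + alpha1; rewrite le_eqVlt => /predU1P[<-|y0].
  rewrite powR0 ?mulr0 ?subrr ?mulr_ge0 ?powR_ge0 ?(ltW a0)//.
  by rewrite gt_eqF// (lt_trans _ alpha1).
have beta0 : 0 < alpha - 1 by rewrite subr_gt0.
have yalpha : y `^ alpha = y * y `^ (alpha - 1).
  rewrite -{2}(powRr1 (ltW y0)) -powRD ?(gt_eqF y0) ?implybT//.
  by rewrite addrC subrK.
have [yab|aby] := leP (y `^ (alpha - 1)) (a / b).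
  apply: (@le_trans _ _ (a * y)).
    by rewrite gerBl mulr_ge0 ?powR_ge0 ?ltW.
  rewrite ler_wpM2l ?(ltW a0)//.
  have -> : y = (y `^ (alpha - 1)) `^ (alpha - 1)^-1.
    by rewrite -powRrM divff ?gt_eqF// powRr1// ltW.
  rewrite ge0_ler_powR//.
  - by rewrite invr_ge0 ltW.
  - by rewrite nnegrE powR_ge0.
  - by rewrite nnegrE divr_ge0// ltW.
apply: (@le_trans _ _ 0); last by rewrite mulr_ge0 ?powR_ge0 ?ltW.
rewrite subr_le0 yalpha mulrCA [leLHS]mulrC ler_wpM2l ?(ltW y0)//.
by rewrite mulrC -ler_pdivrMr// ltW.
Qed.

(** The previous bound with b = c t: the power of t splits off, which is the source of the exponent
    -1 / (alpha - 1) in the final estimate. *)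
Lemma linear_sub_scaled_powR_le a c alpha t y : 0 < a -> 0 < c -> 0 < t ->
  0 <= y -> 1 < alpha ->
  a * y - c * t * y `^ alpha
    <= a * (a / c) `^ (alpha - 1)^-1 * t `^ (- (alpha - 1)^-1).
Proof.
move=> a0 c0 t0 y0 alpha1.
apply: (le_trans (linear_sub_powR_le a0 (mulr_gt0 c0 t0) y0 alpha1)).
rewrite invfM mulrA powRM ?divr_ge0 ?invr_ge0 ?(ltW a0) ?(ltW c0) ?(ltW t0)//.
by rewrite -(powR_inv1 (ltW t0)) -powRrM mulN1r mulrA.
Qed.

(* The term [k = 0] is [0^-1 = 0]. *)
Lemma sum_inv_sqr_le n : \sum_(k < n) (k%:R ^+ 2)^-1 <= 2 :> R.
Proof.
(* Subtracting 1 / (p + 1) makes the induction close, since 1 / k^2 is dominated by a telescoping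
   difference. *)
suff H p : \sum_(k < p.+2) (k%:R ^+ 2)^-1 <= 2 - p.+1%:R^-1 :> R.
  case: n => [|[|p]]; first by rewrite big_ord0.
    by rewrite big_ord1 expr0n invr0.
  by rewrite (le_trans (H p))// gerBl.
elim: p => [|p IHp].
  by rewrite big_ord_recr big_ord1/= expr0n expr1n invr0 invr1 add0r; lra.
rewrite big_ord_recr/= (le_trans (lerD IHp (lexx _)))//.
rewrite -[p.+2%:R]natr1.
have : 0 < p.+1%:R :> R by [].
move: p.+1%:R => q q0; rewrite -subr_ge0.
(* The slack in the induction step is exactly 1 / (q (q + 1)^2). *)
rewrite (_ : _ - _ = (q * (q + 1) ^+ 2)^-1).
  by rewrite invr_ge0 mulr_ge0 ?exprn_ge0// ?addr_ge0// ltW.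
by field; rewrite !gt_eqF// ltr_wpDr.
Qed.

End scalar_estimates.

(** * The real-valued modulus of complex numbers *)

Section complex_modulus.
Variable R : realType.
Implicit Types (z w : R[i]) (x : R).

Lemma cabsE z : cabs z = Num.sqrt (complex.Re z ^+ 2 + complex.Im z ^+ 2).
Proof. by rewrite /cabs normc_def. Qed.

(** Transfers the laws of the norm of [R[i]] to [cabs] through the embedding of the reals. *)
Lemma cabsC z : (cabs z)%:C = `|z|.
Proof. by rewrite cabsE normc_def. Qed.

Lemma cabs_ge0 z : 0 <= cabs z.
Proof. by rewrite cabsE sqrtr_ge0. Qed.

Lemma cabsD z w : cabs (z + w) <= cabs z + cabs w.
Proof. by rewrite -lecR rmorphD/= !cabsC ler_normD. Qed.

Lemma cabsM z w : cabs (z * w) = cabs z * cabs w.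
Proof. by apply: complexI; rewrite rmorphM/= !cabsC normrM. Qed.

Lemma cabs_distC z w : cabs (z - w) = cabs (w - z).
Proof. by apply: complexI; rewrite !cabsC distrC. Qed.

Lemma cabs_real x : cabs x%:C = `|x|.
Proof. by rewrite cabsE/= expr0n addr0 sqrtr_sqr. Qed.

Lemma cabs_conj z : cabs z^*%C = cabs z.
Proof. by rewrite !cabsE; case: z => a b /=; rewrite sqrrN. Qed.

Lemma normr_Re_le_cabs z : `|complex.Re z| <= cabs z.
Proof. by rewrite cabsE -sqrtr_sqr ler_wsqrtr// lerDl sqr_ge0. Qed.

Lemma normr_Im_le_cabs z : `|complex.Im z| <= cabs z.
Proof. by rewrite cabsE -sqrtr_sqr ler_wsqrtr// lerDr sqr_ge0. Qed.

Lemma cabs_le_ReIm z : cabs z <= `|complex.Re z| + `|complex.Im z|.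
Proof.
rewrite -[leRHS]ger0_norm ?addr_ge0// -sqrtr_sqr cabsE ler_wsqrtr//.
by rewrite sqrrD !real_normK ?num_real// lerD2r lerDl mulrn_wge0// mulr_ge0.
Qed.

Lemma cabs_sum (I : Type) (r : seq I) (P : pred I) (F : I -> R[i]) :
  cabs (\sum_(i <- r | P i) F i) <= \sum_(i <- r | P i) cabs (F i).
Proof.
elim/big_ind2: _ => [||//]; first by rewrite (cabs_real 0) normr0.
by move=> z a w b za wb; rewrite (le_trans (cabsD _ _))// lerD.
Qed.

End complex_modulus.

(** * The complex L^2 space and its norm *)

Section L2_norm.
Context d (T : measurableType d) (R : realType).
Variable mu : {measure set T -> \bar R}.
Implicit Types f g h : T -> R[i].

Lemma Lnorm2_ae_le (u v : T -> R) :
  measurable_fun setT u -> measurable_fun setT v ->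
  (\forall x \ae mu, `|u x| <= `|v x|) ->
  ('N[mu]_2[EFin \o u] <= 'N[mu]_2[EFin \o v])%E.
Proof.
move=> mu_ mv uv; rewrite unlock.
apply: gt0_ler_poweR; rewrite ?invr_ge0//.
- by rewrite in_itv/= leey andbT integral_ge0// => x _; exact: poweR_ge0.
- by rewrite in_itv/= leey andbT integral_ge0// => x _; exact: poweR_ge0.
apply: ae_ge0_le_integral => //; try by move=> x _; exact: poweR_ge0.
- apply: (measurableT_comp (measurable_poweR _)).
  exact/measurableT_comp/measurable_EFinP.
- apply: (measurableT_comp (measurable_poweR _)).
  exact/measurableT_comp/measurable_EFinP.
apply: filterS uv => x uv _.
by rewrite lee_fin ge0_ler_powR ?nnegrE.
Qed.

(** Kept apart from [CLfun]: the norm comparisons below are made in the extended reals and allow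
    infinite norms. *)
Definition cmeasurable f :=
  measurable_fun setT (fun x => complex.Re (f x)) /\
  measurable_fun setT (fun x => complex.Im (f x)).

Lemma CLfun_cmeasurable f : CLfun mu 2 f -> cmeasurable f.
Proof.
by move=> []; rewrite !inE => /andP[/[!inE] m1 _] /andP[/[!inE] m2 _].
Qed.

Lemma measurable_cabs f : cmeasurable f -> measurable_fun setT (@cabs R \o f).
Proof.
move=> [m1 m2].
rewrite (_ : _ \o _ = Num.sqrt \o
  (fun x => complex.Re (f x) ^+ 2 + complex.Im (f x) ^+ 2)); last first.
  by apply/funext => x /=; rewrite cabsE.
apply: measurableT_comp; last by apply: measurable_funD; exact: measurable_funX.
by apply: continuous_measurable_fun; exact: sqrt_continuous.
Qed.

Lemma cmeasurable_lin (a : R[i]) f g :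
  cmeasurable f -> cmeasurable g -> cmeasurable (fun x => a * f x + g x).
Proof.
move=> [f1 f2] [g1 g2]; split.
- rewrite (_ : (fun _ => _) = fun x => complex.Re a * complex.Re (f x)
    - complex.Im a * complex.Im (f x) + complex.Re (g x)).
    apply: measurable_funD => //; apply: measurable_funB;
    by apply: measurable_funM.
  apply/funext => x; by case: a (f x) (g x) => [? ?] [? ?] [? ?].
- rewrite (_ : (fun _ => _) = fun x => complex.Re a * complex.Im (f x)
    + complex.Im a * complex.Re (f x) + complex.Im (g x)).
    apply: measurable_funD => //; apply: measurable_funD;
    by apply: measurable_funM.
  by apply/funext => x; case: a (f x) (g x) => [? ?] [? ?] [? ?].
Qed.


Lemma eq_cmeasurable f g : f =1 g -> cmeasurable f -> cmeasurable g.
Proof. by move=> /funext ->. Qed.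

Lemma cmeasurable0 : cmeasurable (fun=> 0).
Proof. by split. Qed.

Lemma cmeasurableZ (a : R[i]) f :
  cmeasurable f -> cmeasurable (fun x => a * f x).
Proof.
move=> mf; apply: eq_cmeasurable (cmeasurable_lin a mf cmeasurable0) => x.
by rewrite addr0.
Qed.

Lemma cmeasurableB f g :
  cmeasurable f -> cmeasurable g -> cmeasurable (fun x => f x - g x).
Proof.
move=> mf mg; apply: eq_cmeasurable (cmeasurable_lin (-1) mg mf) => x.
by rewrite mulN1r addrC.
Qed.

Lemma CLfun_lin (a : R[i]) f g : CLfun mu 2 f -> CLfun mu 2 g ->
  CLfun mu 2 (fun x => a * f x + g x).
Proof.
have [_ L2lin] := Lfun_submod_closed mu (lee1n 2).
have L2D u v : u \in Lfun mu 2 -> v \in Lfun mu 2 -> u + v \in Lfun mu 2.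
  by move=> L2u L2v; rewrite -[u]scale1r; exact: L2lin.
have L2Z c u : u \in Lfun mu 2 -> c *: u \in Lfun mu 2.
  move=> L2u; rewrite -[X in X \in _]addr0; apply: L2lin => //.
  by have [] := Lfun_submod_closed mu (lee1n 2).
move=> [f1 f2] [g1 g2]; split.
- rewrite (_ : (fun _ => _) = (complex.Re a *: (fun x => complex.Re (f x))
    + (- complex.Im a) *: (fun x => complex.Im (f x)))
    + (fun x => complex.Re (g x))); first
    by exact: (L2D _ _ (L2D _ _ (L2Z _ _ f1) (L2Z _ _ f2)) g1).
  apply/funext => x; rewrite !fctE.
  by case: a (f x) (g x) => [? ?] [? ?] [? ?]; rewrite scaleNr.
- rewrite (_ : (fun _ => _) = (complex.Re a *: (fun x => complex.Im (f x))
    + complex.Im a *: (fun x => complex.Re (f x)))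
    + (fun x => complex.Im (g x))); first
    by exact: (L2D _ _ (L2D _ _ (L2Z _ _ f2) (L2Z _ _ f1)) g2).
  by apply/funext => x; rewrite !fctE; case: a (f x) (g x) => [? ?] [? ?] [? ?].
Qed.

Lemma CLfun0 : CLfun mu 2 (fun=> 0).
Proof. by have [? _] := Lfun_submod_closed mu (lee1n 2); split. Qed.

Lemma CLfunZ (a : R[i]) f : CLfun mu 2 f -> CLfun mu 2 (fun x => a * f x).
Proof.
move=> L2f; have := CLfun_lin a L2f CLfun0.
by congr CLfun; apply/funext => x; rewrite addr0.
Qed.

Lemma CLfun_sum (c : nat -> R[i]) (e : nat -> T -> R[i]) n :
  (forall k, CLfun mu 2 (e k)) -> CLfun mu 2 (fun x => \sum_(k < n) c k * e k x).
Proof.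
move=> L2e; elim: n => [|n IHn].
  by under eq_fun do rewrite big_ord0; exact: CLfun0.
under eq_fun do rewrite big_ord_recr/= addrC.
exact: CLfun_lin.
Qed.

Lemma CLnorm2_ae_le f g : cmeasurable f -> cmeasurable g ->
  (\forall x \ae mu, cabs (f x) <= cabs (g x)) ->
  (CLnorm mu 2 f <= CLnorm mu 2 g)%E.
Proof.
move=> mf mg fg; apply: Lnorm2_ae_le; try exact: measurable_cabs.
by apply: filterS fg => x; rewrite /= !ger0_norm ?cabs_ge0.
Qed.

Lemma CLnorm2_ae_eq f g : cmeasurable f -> cmeasurable g ->
  f = g %[ae mu] -> CLnorm mu 2 f = CLnorm mu 2 g.
Proof.
move=> mf mg fg; apply/le_anti/andP.
by split; apply: CLnorm2_ae_le => //; apply: filterS fg => x -> .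
Qed.

(** The pointwise triangle inequality for [cabs] reduces this to Minkowski's inequality for the real
    functions |f| and |g|. *)
Lemma CLnormD f g : cmeasurable f -> cmeasurable g ->
  (CLnorm mu 2 (fun x => (f x + g x)%R) <= CLnorm mu 2 f + CLnorm mu 2 g)%E.
Proof.
move=> mf mg.
have mabs := measurable_cabs; apply: le_trans (minkowski_EFin _ _ _ _).
- apply: Lnorm2_ae_le; [|by apply: measurable_funD; exact: mabs|].
    apply: mabs; apply: eq_cmeasurable (cmeasurable_lin 1 mf mg) => x.
    by rewrite mul1r.
  apply: nearW => x /=.
  by rewrite ger0_norm ?cabs_ge0// ger0_norm ?addr_ge0 ?cabs_ge0 ?cabsD.
- exact: mabs.
- exact: mabs.
- by rewrite ler1n.
Qed.

Lemma CLnormZ (a : R[i]) f : cmeasurable f ->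
  CLnorm mu 2 (fun x => a * f x) = ((cabs a)%:E * CLnorm mu 2 f)%E.
Proof.
move=> /measurable_cabs mf; rewrite /CLnorm unlock.
under eq_integral => x _.
  rewrite /= cabsM normrM (ger0_norm (cabs_ge0 a)).
  rewrite powRM ?cabs_ge0// EFinM; over.
rewrite ge0_integralZl//; first last.
- by rewrite lee_fin powR_ge0.
- apply/measurable_EFinP/(measurableT_comp (measurable_powR _)).
  exact: measurableT_comp.
rewrite poweRM ?integral_ge0// ?lee_fin ?powR_ge0//.
by rewrite poweR_EFin -powRrM mulfV// powRr1// cabs_ge0.
Qed.

(** [CLfun] controls the two real parts separately; |z| <= |Re z| + |Im z| and Minkowski combine
    them. *)
Lemma CLnorm_lty f : CLfun mu 2 f -> (CLnorm mu 2 f < +oo)%E.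
Proof.
move=> /[dup] L2f [].
have [m1 m2] := CLfun_cmeasurable L2f.
rewrite !inE => /andP[_ /[!inE] f1] /andP[_ /[!inE] f2].
move: f1 f2; rewrite /finite_norm/= => f1 f2.
apply: (@le_lt_trans _ _ ('N[mu]_2[EFin \o (fun x => complex.Re (f x))] +
    'N[mu]_2[EFin \o (fun x => complex.Im (f x))])%E); last first.
  exact: lte_add_pinfty.
have mabs (u : T -> R) : measurable_fun setT u ->
    measurable_fun setT (fun x => `|u x|) by exact: measurableT_comp.
rewrite -[X in (_ <= X + _)%E]Lnorm_abse -[X in (_ <= _ + X)%E]Lnorm_abse.
apply: le_trans (minkowski_EFin _ (mabs _ m1) (mabs _ m2) _).
  apply: Lnorm2_ae_le; first exact: measurable_cabs.
    by apply: measurable_funD; exact: mabs.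
  apply: nearW => x /=.
  by rewrite (ger0_norm (cabs_ge0 _)) (ger0_norm (addr_ge0 _ _)) ?cabs_le_ReIm.
by rewrite ler1n.
Qed.

Lemma CLnorm2_eq0 f : cmeasurable f -> CLnorm mu 2 f = 0%E ->
  f = (fun=> 0) %[ae mu].
Proof.
move=> /measurable_cabs/measurable_EFinP mf /(Lnorm_eq0_eq0 mf).
rewrite lte_fin ltr0n => /(_ isT); apply: filterS => x /(_ I) [fx0] _.
by apply/eqP; rewrite -normr_eq0 -cabsC fx0.
Qed.


End L2_norm.

(** * The inner product, and almost everywhere bounds *)

Section L2_pairing.
Context d (T : measurableType d) (R : realType).
Variable mu : {measure set T -> \bar R}.
Implicit Types f g h : T -> R[i].

Lemma cmeasurable_mul_conj f g : cmeasurable f -> cmeasurable g ->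
  cmeasurable (fun x => f x * (g x)^*%C).
Proof.
move=> [f1 f2] [g1 g2]; split.
- rewrite (_ : (fun _ => _) = fun x => complex.Re (f x) * complex.Re (g x)
    + complex.Im (f x) * complex.Im (g x)).
    by apply: measurable_funD; exact: measurable_funM.
  by apply/funext => x; case: (f x) (g x) => [? ?] [? ?] /=; rewrite mulrN opprK.
- rewrite (_ : (fun _ => _) = fun x => complex.Im (f x) * complex.Re (g x)
    - complex.Re (f x) * complex.Im (g x)).
    by apply: measurable_funB; exact: measurable_funM.
  apply/funext => x; case: (f x) (g x) => [? ?] [? ?] /=.
  by rewrite mulrN addrC.
Qed.

(** Here [u] stands for the real or the imaginary part of the integrand of [inner]. *)
Lemma normr_Rintegral_le_hoelder f g (u : T -> R) :
  cmeasurable f -> cmeasurable g -> measurable_fun setT u ->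
  (forall x, `|u x| <= cabs (f x) * cabs (g x)) ->
  (`|\int[mu]_x u x|%:E <= CLnorm mu 2 f * CLnorm mu 2 g)%E.
Proof.
move=> /measurable_cabs mf /measurable_cabs mg mu_ ufg.
apply: (@le_trans _ _ (`|\int[mu]_x (u x)%:E|)%E).
  (* An infinite integral has [Rintegral] equal to 0, so the bound holds in that case too. *)
  by rewrite /Rintegral; case: (\int[mu]_x _)%E => //= *; rewrite ?normr0 ?leey.
apply: (le_trans (le_abse_integral _ _ _)) => //; first exact/measurable_EFinP.
have half : 2^-1 + 2^-1 = 1 :> R by rewrite [RHS]splitr !div1r.
apply: le_trans (hoelder mu mf mg _ _ half) => //.
rewrite Lnorm1; apply: ge0_le_integral => //.
- by apply/measurable_EFinP; exact: measurableT_comp.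
- apply/measurable_EFinP; apply: measurableT_comp => //.
  exact: measurable_funM.
- by move=> x _; rewrite lee_fin/= (ger0_norm (mulr_ge0 _ _)) ?cabs_ge0.
Qed.

Lemma cabs_inner_le f g : cmeasurable f -> cmeasurable g ->
  ((cabs (inner mu f g))%:E <= 2%:E * (CLnorm mu 2 f * CLnorm mu 2 g))%E.
Proof.
move=> mf mg; have [m1 m2] := cmeasurable_mul_conj mf mg.
have cabs_prod x : cabs (f x * (g x)^*%C) = cabs (f x) * cabs (g x).
  by rewrite cabsM cabs_conj.
apply: (@le_trans _ _ (`|complex.Re (inner mu f g)|%:E
    + `|complex.Im (inner mu f g)|%:E)%E).
  by rewrite -EFinD lee_fin cabs_le_ReIm.
rewrite (_ : 2%:E = 1 + 1)%E// ge0_muleDl// !mul1e.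
apply: leeD; apply: normr_Rintegral_le_hoelder => // x; rewrite -cabs_prod.
- exact: normr_Re_le_cabs.
- exact: normr_Im_le_cabs.
Qed.

Lemma CLnorm_unit f : inner mu f f = 1 -> CLnorm mu 2 f = 1%E.
Proof.
move=> /(congr1 (@complex.Re R))/=; rewrite /Rintegral => int1.
have : (\int[mu]_x (`|(EFin \o @cabs R \o f) x| `^ 2) = 1)%E.
  under eq_integral => x _.
    rewrite /= ger0_norm ?cabs_ge0// powR_mulrn ?cabs_ge0// cabsE.
    rewrite sqr_sqrtr ?addr_ge0 ?sqr_ge0//; over.
  rewrite -int1 fineK.
    apply: eq_integral => x _; case: (f x) => a b /=.
    by rewrite mulrN opprK -!expr2.
  (* The integral is finite: [fine] sends infinite values to 0, whereas here its value is 1. *)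
  by move: int1; case: (\int[mu]_x _)%E => //= /eqP; rewrite eq_sym oner_eq0.
by move=> eq1; rewrite /CLnorm unlock eq1 poweR1r.
Qed.

(* The excess [max(|h| - M, 0)] is dominated by [|u - h|] whenever [|u| <= M]. *)
Lemma ae_bound_L2_closed h (M : R) : cmeasurable h ->
  (forall e : R, 0 < e -> exists u, [/\ cmeasurable u,
    \forall x \ae mu, cabs (u x) <= M &
    (CLnorm mu 2 (fun x => (h x - u x)%R) <= e%:E)%E]) ->
  \forall x \ae mu, cabs (h x) <= M.
Proof.
move=> mh approx; pose phi x := Num.max (cabs (h x) - M) 0.
have mphi : measurable_fun setT phi.
  apply: measurable_funrpos; apply: measurable_funB => //.
  exact: measurable_cabs.
have phi0 : 'N[mu]_2[EFin \o phi]%E = 0%E.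
  apply/le_anti/andP; split; last exact: Lnorm_ge0.
  apply/lee_addgt0Pr => e /approx[u [mu_ uM hu]]; rewrite add0e.
  have mhu := cmeasurableB mh mu_.
  apply: le_trans hu; apply: Lnorm2_ae_le => //; first exact: measurable_cabs.
  apply: filterS uM => x uM; rewrite /phi /=.
  rewrite (ger0_norm (cabs_ge0 _)) ger0_norm ?le_max ?lexx ?orbT//.
  rewrite ge_max cabs_ge0 andbT lerBlDr -{1}(subrK (u x) (h x)).
  by rewrite (le_trans (cabsD _ _))// lerD2l.
have := Lnorm_eq0_eq0 (iffRL (measurable_EFinP _ _) mphi) _ phi0.
rewrite lte_fin ltr0n => /(_ isT); apply: filterS => x /(_ I)[].
by rewrite /phi => /eqP; rewrite eq_le ge_max subr_le0 => /andP[/andP[]].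
Qed.

Lemma CLnormy_ae_le f (M : R) : (CLnorm mu +oo f <= M%:E)%E ->
  \forall x \ae mu, cabs (f x) <= M.
Proof.
rewrite /CLnorm unlock; case: ifPn => [_ /ess_supP|].
  by apply: filterS => x /=; rewrite lee_fin ger0_norm ?cabs_ge0.
(* On a space of measure zero the L^oo norm is 0 by convention, and the whole space serves as
   exceptional null set. *)
rewrite -leNgt => mu0 _.
have {}mu0 : mu setT = 0%E by apply/eqP; rewrite eq_le mu0 measure_ge0.
by exists setT; split.
Qed.

Lemma ae_le_CLnormy f (M : R) : 0 <= M ->
  (\forall x \ae mu, cabs (f x) <= M) -> (CLnorm mu +oo f <= M%:E)%E.
Proof.
(* The sign of M settles the case of a null space, where the norm is 0. *)
move=> M0 fM; rewrite /CLnorm unlock; case: ifPn => _; last by rewrite lee_fin.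
by apply/ess_supP; apply: filterS fM => x; rewrite /= lee_fin ger0_norm ?cabs_ge0.
Qed.

End L2_pairing.

(** * Smallness along a filter, and the remainder of the exponential *)

Lemma cvge0_near (R : realType) (I : Type) (F : set_system I)
  {FF : Filter F} (u : I -> \bar R) (e : R) : u i @[i --> F] --> 0%E -> 0 < e ->
  \forall i \near F, (u i < e%:E)%E.
Proof.
move=> u0 e0; apply: (u0 [set x | (x < e%:E)%E]).
by apply: open_ereal_lt'; rewrite lte_fin.
Qed.

(** From exp(-x) >= 1 - x and exp(-x) <= 1 / (1 + x). The quadratic order makes this error
    negligible against s as s tends to 0. *)
Lemma expRN_sub_linear_le (R : realType) (x : R) : 0 <= x ->
  `|1 - x - expR (- x)| <= x ^+ 2.
Proof.
move=> x0; have := expR_ge1Dx (- x); have := expR_ge1Dx x.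
have := expRxMexpNx_1 x; have := expR_gt0 (- x).
move: (expR x) (expR (- x)) => E F F0 EF Ex Fx.
by rewrite distrC ler_norml; apply/andP; split; nra.
Qed.

(** * Linearity and contraction of the semigroup, up to null sets *)

Section semigroup_facts.
Context d (T : measurableType d) (R : realType).
Variable mu : {measure set T -> \bar R}.
Variable H : (T -> R[i]) -> (T -> R[i]) -> Prop.
Variable S : R -> (T -> R[i]) -> T -> R[i].
Hypothesis semiS : is_semigroup mu H S.
Implicit Types f g : T -> R[i].

Let measS (t : R) f : 0 <= t -> CLfun mu 2 f -> cmeasurable (S t f).
Proof. by move=> t0 L2f; exact/CLfun_cmeasurable/(semigroup_CLfun semiS). Qed.

Let measE := @CLfun_cmeasurable _ _ _ mu.

Lemma semigroup_zero (t : R) : 0 <= t -> S t (fun=> 0) = (fun=> 0) %[ae mu].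
Proof.
move=> t0; apply: CLnorm2_eq0; first by apply: measS => //; exact: CLfun0.
apply/le_anti/andP; split; last exact: Lnorm_ge0.
rewrite (le_trans (semigroup_contraction semiS t0 (CLfun0 mu)))//.
rewrite /CLnorm (_ : _ \o _ = cst 0%E) ?Lnorm0//.
by apply/funext => x /=; rewrite (cabs_real 0) normr0.
Qed.

Lemma semigroup_sum (t : R) (c : nat -> R[i]) (e : nat -> T -> R[i]) n :
  0 <= t -> (forall k, CLfun mu 2 (e k)) ->
  S t (fun x => \sum_(k < n) c k * e k x)
    = (fun x => \sum_(k < n) c k * S t (e k) x) %[ae mu].
Proof.
move=> t0 L2e; elim: n => [|n IHn].
  rewrite (_ : (fun x => \sum_(k < 0) c k * e k x) = fun=> 0); last first.
    by apply/funext => x; rewrite big_ord0.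
  by apply: filterS (semigroup_zero t0) => x + Tx => ->//; rewrite big_ord0.
rewrite (_ : (fun x => \sum_(k < n.+1) c k * e k x) =
    fun x => c n * e n x + \sum_(k < n) c k * e k x); last first.
  by apply/funext => x; rewrite big_ord_recr/= addrC.
have lin := semigroup_linear semiS (c n) t0 (L2e n) (CLfun_sum c n L2e).
apply: filterS2 IHn lin => x IHn lin Tx.
by rewrite lin// IHn// big_ord_recr/= addrC.
Qed.

(** By linearity the difference of the images is the image of the difference, to which contraction
    applies. *)
Lemma semigroup_dist_le (t : R) f g : 0 <= t -> CLfun mu 2 f -> CLfun mu 2 g ->
  (CLnorm mu 2 (fun x => (S t f x - S t g x)%R)
    <= CLnorm mu 2 (fun x => (f x - g x)%R))%E.
Proof.
move=> t0 L2f L2g.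
have subE u v : (fun x => u x - v x) = (fun x => -1 * v x + u x) :> (T -> R[i]).
  by apply/funext => x; rewrite mulN1r addrC.
rewrite !subE; have L2D := CLfun_lin (-1) L2g L2f.
apply: le_trans (semigroup_contraction semiS t0 L2D).
rewrite (CLnorm2_ae_eq _ _ (semigroup_linear semiS (-1) t0 L2g L2f))//.
- exact: measS.
- by apply: cmeasurable_lin; exact: measS.
Qed.

(** * From eigenfunctions of [H] to eigenfunctions of the semigroup *)

Section eigenfunction.
Variables (l : R) (f : T -> R[i]).
Hypotheses (l0 : 0 <= l) (L2f : CLfun mu 2 f) (eigf : eigenvector H l%:C f).

(** The defect at time s; the aim is that it vanishes almost everywhere. *)
Let D (s : R) x := S s f x - (expR (- (l * s)))%:C * f x.

Let L2D (s : R) : 0 <= s -> CLfun mu 2 (D s).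
Proof.
move=> s0; have L2S := semigroup_CLfun semiS s0 L2f.
have := CLfun_lin (- (expR (- (l * s)))%:C) L2f L2S.
by congr CLfun; apply/funext => x; rewrite mulNr addrC.
Qed.

(* Telescoping the semigroup law along the steps [s, 2 s, ..., m s]. *)
Let D_mul (m : nat) (s : R) : 0 <= s ->
  (CLnorm mu 2 (D (m%:R * s)) <= m%:R%:E * CLnorm mu 2 (D s))%E.
Proof.
move=> s0; elim: m => [|m IHm].
  rewrite mul0r mul0e.
  rewrite (_ : CLnorm mu 2 (D 0) = CLnorm mu 2 (fun x => 0 * f x)).
    by rewrite CLnormZ ?(cabs_real 0) ?normr0 ?mul0e//; exact: measE.
  apply: CLnorm2_ae_eq; first exact/measE/L2D.
    exact/cmeasurableZ/measE.
  apply: filterS (semigroup_0 semiS L2f) => x Sf0 Tx.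
  by rewrite /D Sf0// mulr0 oppr0 expR0 mul1r subrr mul0r.
have ms0 : 0 <= m%:R * s by rewrite mulr_ge0.
set e := (expR (- (l * s)))%:C.
have Ds : S s f = (fun x => e * f x + D s x).
  by apply/funext => x; rewrite /D addrC subrK.
have msD : m.+1%:R * s = m%:R * s + s by rewrite -natr1 mulrDl mul1r.
rewrite msD; set t := m%:R * s in ms0 msD IHm *.
(* Apply S_t to S_s f = e f + D_s. Both terms on the right are then controlled, since e <= 1 and S_t
   is a contraction. *)
have step : D (t + s) = (fun x => e * D t x + S t (D s) x) %[ae mu].
  have := semigroup_linear semiS e ms0 L2f (L2D s0); rewrite -Ds.
  apply: filterS2 (semigroup_D semiS ms0 s0 L2f) => x h1 h2 Tx.
  rewrite {1}/D h1// h2// /D mulrBr mulrA -rmorphM/= -expRD.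
  by rewrite -opprD -mulrDr [s + t]addrC addrAC.
have meD := cmeasurableZ e (measE (L2D ms0)).
have mSD : cmeasurable (S t (D s)) by apply: measS => //; exact: L2D.
rewrite (CLnorm2_ae_eq _ _ step); first last.
- by apply: cmeasurable_lin => //; exact/measE/L2D.
- by apply/measE/L2D; rewrite addr_ge0.
apply: (le_trans (CLnormD mu meD mSD)).
have -> : (m.+1%:R%:E = m%:R%:E + 1 :> \bar R)%E by rewrite -natr1 EFinD.
rewrite ge0_muleDl ?lee_fin// mul1e; apply: leeD.
  rewrite CLnormZ; last exact/measE/L2D.
  apply: le_trans IHm; rewrite -[leRHS]mul1e lee_wpmul2r ?Lnorm_ge0//.
  rewrite lee_fin cabs_real ger0_norm ?expR_ge0// -expR0 ler_expR.
  by rewrite oppr_le0 mulr_ge0.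
exact/(semigroup_contraction semiS)/L2D.
Qed.

(** The defect is o(s), because (f - S_s f) / s tends to l f by the generator property. *)
Let D_small (e : R) : 0 < e ->
  \forall s \near 0^'+, (CLnorm mu 2 (D s) <= (s * e)%:E)%E.
Proof.
move=> e0.
have L2lf := CLfunZ l%:C L2f.
have /(_ eigf) gen := iffLR (semigroup_generator semiS L2f L2lf).
have F0 : (0 <= CLnorm mu 2 f)%E by exact: Lnorm_ge0.
have Ffin : CLnorm mu 2 f \is a fin_num by rewrite ge0_fin_numE// CLnorm_lty.
set F := fine (CLnorm mu 2 f); have FE : CLnorm mu 2 f = F%:E by rewrite fineK.
have {}F0 : 0 <= F by exact: fine_ge0.
have e2 : 0 < e / 2 by rewrite divr_gt0.
have M0 : 0 < l ^+ 2 * F + 1 by rewrite ltr_wpDl// mulr_ge0// sqr_ge0.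
have genlt := cvge0_near gen e2.
near=> s.
have s0 : 0 < s by near: s; exact: nbhs_right_gt.
(* Ensures s l^2 F <= e / 2; the [+ 1] keeps the denominator positive when l or F is 0. *)
have sM : s < e / 2 / (l ^+ 2 * F + 1).
  by near: s; apply: nbhs_right_lt; rewrite divr_gt0.
have Ge : (CLnorm mu 2 (fun x => s^-1%:C * (f x - S s f x) - l%:C * f x)%R
    < (e / 2)%:E)%E by near: s; exact: genlt.
set G := (X in CLnorm mu 2 X) in Ge.
have mS : cmeasurable (S s f) by apply: measS => //; exact: ltW.
have mG : cmeasurable G.
  apply: cmeasurableB; apply: cmeasurableZ; last exact: measE.
  by apply: cmeasurableB => //; exact: measE.
(* Splits the defect into the error G of the difference quotient and the second-order remainder of
   the exponential. *)
have DE : D s = fun x => (- s%:C) * G x + (1 - l * s - expR (- (l * s)))%:C * f x.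
  apply/funext => x; rewrite /D /G.
  have ss : s%:C * s^-1%:C = 1 :> R[i] by rewrite -rmorphM/= divff// gt_eqF.
  rewrite mulrBr mulrA mulNr ss !rmorphB !rmorphM/= rmorph1; ring.
have mF := measE L2f; rewrite DE.
apply: (le_trans (CLnormD mu (cmeasurableZ _ mG) (cmeasurableZ _ mF))).
rewrite !CLnormZ//.
rewrite -rmorphN !cabs_real normrN (ger0_norm (ltW s0)) FE.
apply: (@le_trans _ _ (s%:E * (e / 2)%:E + ((l * s) ^+ 2)%:E * F%:E)%E).
  apply: leeD; first by rewrite lee_wpmul2l ?(ltW Ge)// lee_fin ltW.
  by rewrite lee_wpmul2r ?lee_fin// expRN_sub_linear_le// mulr_ge0// ltW.
rewrite -!EFinM -EFinD lee_fin.
rewrite (_ : (l * s) ^+ 2 * F = s * (s * (l ^+ 2 * F))); last by ring.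
rewrite -mulrDr ler_pM2l//.
by move: sM; rewrite ltr_pdivlMr// mulrDr mulr1 => sM; lra.
Unshelve. all: by end_near. Qed.

Lemma semigroup_eigenfunction (t : R) : 0 <= t ->
  S t f = (fun x => (expR (- (l * t)))%:C * f x) %[ae mu].
Proof.
move=> t0; suff : D t = (fun=> 0) %[ae mu].
  by apply: filterS => x + Tx => /(_ Tx) /eqP; rewrite subr_eq0 => /eqP.
apply: CLnorm2_eq0; first exact/measE/L2D.
apply/le_anti/andP; split; last exact: Lnorm_ge0.
apply/lee_addgt0Pr => e e0; rewrite add0e.
have t10 : 0 < t + 1 by rewrite ltr_wpDl.
(* With tolerance e / (t + 1), the m + 1 steps of length t / (m + 1) add up to t e / (t + 1) <=
   e. *)
have /nbhs_ballP[r /= r0 smallr] := D_small (divr_gt0 e0 t10).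
pose m := Num.truncn (t / r); have m0 : 0 < m.+1%:R :> R by [].
(* Time 0 lies outside the right neighbourhood and is treated by zero steps. *)
have [->|tN0] := eqVneq t 0.
  have := D_mul 0 (lexx 0); rewrite mul0r mul0e => /le_trans; apply.
  by rewrite lee_fin ltW.
have {}t0 : 0 < t by rewrite lt_neqAle eq_sym tN0.
have s0 : 0 < t / m.+1%:R by rewrite divr_gt0.
have sr : t / m.+1%:R < r.
  by rewrite ltr_pdivrMr// mulrC -ltr_pdivrMr// truncnS_gt.
have Ds : (CLnorm mu 2 (D (t / m.+1%:R)) <= (t / m.+1%:R * (e / (t + 1)))%:E)%E.
  by apply: smallr => //; rewrite /ball/= sub0r normrN ger0_norm// ltW.
rewrite -{1}(divfK (lt0r_neq0 m0) t) [_ / _ * _]mulrC.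
apply: (le_trans (D_mul _ (ltW s0))).
apply: (le_trans (lee_wpmul2l _ Ds)); first by rewrite lee_fin.
rewrite -EFinM lee_fin mulrA [_ * (t / _)]mulrC divfK ?gt_eqF//.
by rewrite mulrCA ler_piMr ?(ltW e0)// ler_pdivrMr// mul1r lerDl.
Qed.

End eigenfunction.
End semigroup_facts.

(** * L^oo bound from the eigenfunction expansion *)

Section ultracontractivity.
Context d (T : measurableType d) (R : realType).
Variable mu : {measure set T -> \bar R}.
Variable H : (T -> R[i]) -> (T -> R[i]) -> Prop.

(* [|(g, e_k)| <= 2 ||g||_2] bounds the partial sums of the eigenfunction
   expansion of [S t g] in L^oo, and the bound passes to their L^2 limit. *)
Lemma semigroup_eigenexpansion_Linfty (S : R -> (T -> R[i]) -> T -> R[i])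
    (l : nat -> R) (e : nat -> T -> R[i]) (b : nat -> R) (t B : R)
    (g : T -> R[i]) :
  is_semigroup mu H S -> orthonormal_basis mu e ->
  (forall k, 0 <= l k) -> (forall k, eigenvector H (l k)%:C (e k)) ->
  (forall k, (CLnorm mu +oo (e k) <= (b k)%:E)%E) ->
  (forall n, \sum_(k < n) expR (- (l k * t)) * b k <= B) ->
  0 <= t -> CLfun mu 2 g ->
  (CLnorm mu +oo (S t g) <= (2 * B)%:E * CLnorm mu 2 g)%E.
Proof.
move=> semiS [L2e orthe basise] l0 eige eb sumB t0 L2g.
have B0 : 0 <= B by have := sumB 0; rewrite big_ord0.
have Gfin : CLnorm mu 2 g \is a fin_num.
  by rewrite ge0_fin_numE ?CLnorm_lty// Lnorm_ge0.
set G := fine (CLnorm mu 2 g); have GE : CLnorm mu 2 g = G%:E by rewrite fineK.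
have G0 : 0 <= G by exact/fine_ge0/Lnorm_ge0.
have meas := @CLfun_cmeasurable _ _ _ mu.
pose c k := inner mu g (e k).
have cG k : cabs (c k) <= 2 * G.
  rewrite -lee_fin (le_trans (cabs_inner_le mu (meas _ L2g) (meas _ (L2e k))))//.
  by rewrite (CLnorm_unit (f := e k)) ?orthe ?eqxx// mule1 GE.
rewrite GE -EFinM; apply: ae_le_CLnormy; first by rewrite !mulr_ge0.
have L2Stg : CLfun mu 2 (S t g) by exact: (semigroup_CLfun semiS).
apply: ae_bound_L2_closed; first exact: meas.
(* Truncate the expansion of g within eps in L^2; the image of the truncation under S_t is the
   bounded approximant of S_t g. *)
move=> eps eps0; have [n Pn] := filter_ex (cvge0_near (basise g L2g) eps0).
pose P x := \sum_(k < n) c k * e k x.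
pose ev k x := (expR (- (l k * t)))%:C * e k x.
have L2P : CLfun mu 2 P by exact: CLfun_sum.
have L2ev k : CLfun mu 2 (ev k) by exact: CLfunZ.
exists (fun x => \sum_(k < n) c k * ev k x); split.
- exact/meas/CLfun_sum.
(* The sup bounds hold simultaneously for all k off one null set, a countable union. *)
- have /ae_foralln ae_eb := fun k => CLnormy_ae_le (eb k).
  apply: filterS ae_eb => x ebx; apply: (le_trans (cabs_sum _ _ _)).
  rewrite mulrAC; apply: le_trans (ler_wpM2l _ (sumB n)); last first.
    by rewrite mulr_ge0.
  rewrite mulr_sumr ler_sum// => k _.
  rewrite !cabsM cabs_real (ger0_norm (expR_ge0 _)).
  by rewrite ler_pM ?cabs_ge0 ?mulr_ge0 ?cabs_ge0 ?expR_ge0// ler_wpM2l ?expR_ge0.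
- have StP : S t P = (fun x => \sum_(k < n) c k * ev k x) %[ae mu].
    have /ae_foralln eigS := fun k =>
      semigroup_eigenfunction semiS (l0 k) (L2e k) (eige k) t0.
    apply: filterS2 (semigroup_sum semiS c n t0 L2e) eigS => x StPx eigSx Tx.
    by rewrite StPx//; apply: eq_bigr => k _; rewrite eigSx.
  have L2StP : CLfun mu 2 (S t P) by exact: (semigroup_CLfun semiS).
  rewrite (@CLnorm2_ae_eq _ _ _ _ _ (fun x => S t g x - S t P x)); first last.
  + by apply: filterS StP => x StPx Tx; rewrite StPx.
  + by apply: cmeasurableB; exact: meas.
  + by apply: cmeasurableB; apply: meas => //; exact: CLfun_sum.
  (* Contraction carries the truncation error of g over to S_t g. *)
  apply: (le_trans (semigroup_dist_le semiS t0 L2g L2P)).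
  apply: le_trans (ltW Pn).
  apply: CLnorm2_ae_le; try by apply: cmeasurableB; exact: meas.
  by apply: nearW => x; rewrite cabs_distC.
Qed.

End ultracontractivity.

(** * Summing the heat factors against the eigenfunction bounds *)

Section heat_sum.
Variables (R : realType) (c6 c7 c8 c9 : R) (n0 : nat) (alpha : R).
Hypotheses (c6_gt0 : 0 < c6) (c7_gt0 : 0 < c7) (c8_gt0 : 0 < c8) (c9_gt0 : 0 < c9)
  (n0_gt : c7^-1 < n0%:R) (alpha_gt1 : 1 < alpha).

Let s t := t `^ (- (alpha - 1)^-1).
(** The two summands are the constants of [linear_sub_scaled_powR_le] for (a, c) = (c9, 1/2) and (2,
    c6/2). *)
Let C4 := c9 * (c9 / 2^-1) `^ (alpha - 1)^-1
  + 2 * (2 / (c6 / 2)) `^ (alpha - 1)^-1.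

Let C4_gt0 : 0 < C4.
Proof. by rewrite addr_gt0// mulr_gt0// powR_gt0// !divr_gt0. Qed.

(* Half of [t l] absorbs the growth of the eigenfunction, the other half gives
   the summable factor [expR (- 2 L) = (c7 k)^-2]. *)
Lemma heat_term_le (t l : R) (k : nat) : 0 < t -> (n0 <= k)%N -> 0 <= l ->
  c6 * ln (c7 * k%:R) `^ alpha <= l ->
  expR (- (l * t)) * expR (c9 * l `^ alpha^-1)
    <= expR (C4 * s t) * ((c7 ^+ 2)^-1 * (k%:R ^+ 2)^-1).
Proof.
move=> t0 n0k l0; set L := ln _ => Ll.
have alpha0 : 0 < alpha by exact: lt_trans alpha_gt1.
(* The condition n0 > 1 / c7 enters here: it makes the logarithm L nonnegative. *)
have c7k : 1 < c7 * k%:R.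
  by rewrite mulrC -ltr_pdivrMr// div1r (lt_le_trans n0_gt)// ler_nat.
have L0 : 0 <= L by rewrite ln_ge0// ltW.
have half0 : 0 < 2^-1 :> R by [].
have := linear_sub_scaled_powR_le c9_gt0 half0 t0 (powR_ge0 l alpha^-1) alpha_gt1.
rewrite -powRrM mulVf ?gt_eqF// powRr1// => h1.
have c62 : 0 < c6 / 2 by rewrite divr_gt0.
have h2 := linear_sub_scaled_powR_le (ltr0Sn R 1) c62 t0 L0 alpha_gt1.
have h3 : t / 2 * (c6 * L `^ alpha) <= t / 2 * l.
  by rewrite ler_wpM2l// ltW// divr_gt0.
have -> : (c7 ^+ 2)^-1 * (k%:R ^+ 2)^-1 = expR (- (2 * L)).
  rewrite -invfM -exprMn expRN expRM_natl lnK// posrE.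
  exact: lt_trans c7k.
rewrite -!expRD ler_expR /C4 /s mulrDl.
(* The sum of [h1], [h2] and [h3]: the terms in L^alpha cancel and the two halves of t l
   recombine. *)
nra.
Qed.

Lemma heat_sum_le : exists K C : R, [/\ 0 < K, 0 < C &
  forall (t : R) (l : nat -> R) n, 0 < t -> (forall k, 0 <= l k) ->
  (forall k, (n0 <= k)%N -> c6 * ln (c7 * k%:R) `^ alpha <= l k) ->
  \sum_(k < n) expR (- (l k * t)) *
      (if (k < n0)%N then c8 else c8 * expR (c9 * l k `^ alpha^-1))
    <= K * expR (C * t `^ (- (alpha - 1)^-1))].
Proof.
(* The part c8 n0 pays for the first n0 terms, and 2 c8 / c7^2 for the tail of inverse squares. *)
exists (c8 * (n0%:R + 2 * (c7 ^+ 2)^-1)), C4; split => //.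
  by rewrite mulr_gt0// ltr_wpDl// mulr_gt0// invr_gt0 exprn_gt0.
move=> t l n t0 l0 lge; rewrite -/(s t); set E := expR (C4 * s t).
have E1 : 1 <= E by rewrite -expR0 ler_expR mulr_ge0 ?powR_ge0// ltW.
have E0 : 0 <= E by exact: expR_ge0.
have cE0 : 0 <= c8 * E by rewrite mulr_ge0// ltW.
(* One majorant for both ranges of k, so that the sum splits into a count of the indices below n0
   and a series of inverse squares. *)
pose u k : R := c8 * E * (k < n0)%N%:R + c8 * E * (c7 ^+ 2)^-1 * (k%:R ^+ 2)^-1.
apply: (@le_trans _ _ (\sum_(k < n) u k)).
  apply: ler_sum => k _; rewrite /u; case: ltnP => [kn0|n0k].
    apply: ler_wpDr.
      by rewrite (mulr_ge0 (mulr_ge0 cE0 _)) ?invr_ge0 ?exprn_ge0// ltW.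
    rewrite mulr1 mulrC ler_wpM2l ?(ltW c8_gt0)// (le_trans _ E1)//.
    by rewrite -expR0 ler_expR oppr_le0 mulr_ge0// ltW.
  rewrite mulr0 add0r mulrCA -!mulrA ler_wpM2l ?(ltW c8_gt0)//.
  exact/heat_term_le/lge.
rewrite big_split/= -!mulr_sumr mulrDr mulrDl; apply: lerD.
  rewrite [leRHS]mulrAC ler_wpM2l//.
  rewrite -natr_sum ler_nat.
  suff -> : (\sum_(k < n) (k < n0) = minn n n0)%N by exact: geq_minr.
  elim: n => [|n IHn]; first by rewrite big_ord0 min0n.
  by rewrite big_ord_recr/= IHn; case: ltnP; lia.
rewrite [leRHS](_ : _ = c8 * E * (c7 ^+ 2)^-1 * 2); last by ring.
rewrite ler_wpM2l ?sum_inv_sqr_le//.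
by rewrite (mulr_ge0 cE0)// invr_ge0 exprn_ge0// ltW.
Qed.

End heat_sum.

(** * The ultracontractive bound for Neumann Laplacians *)

Theorem corollary2p5 (R : realType) (c6 c7 c8 c9 : R) (n0 : nat) (alpha : R)
    (c6_gt0 : 0 < c6) (c7_gt0 : 0 < c7) (c8_gt0 : 0 < c8) (c9_gt0 : 0 < c9)
    (n0_gt : c7^-1 < n0%:R) (alpha_gt1 : 1 < alpha) :
  exists C3 C4 : R, [/\ 0 < C3, 0 < C4 &
    forall (N : nat) (Omega : set 'rV[R]_N) (rO : region Omega),
    let vol := volume (region_open rO) in
    let HN := neumann_laplacian (region_open rO) in
    forall (lambda : nat -> R) (f : nat -> 'rV[R]_N -> R[i]),
    discrete_spectrum vol HN ->
    (forall n, 0 <= lambda n) ->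
    (forall m n, (m <= n)%N -> lambda m <= lambda n) ->
    orthonormal_basis vol f ->
    (forall n, eigenvector HN (lambda n)%:C (f n)) ->
    (forall n, (n0 <= n)%N -> c6 * ln (c7 * n%:R) `^ alpha <= lambda n) ->
    (forall n, (n < n0)%N -> (CLnorm vol +oo (f n) <= c8%:E)%E) ->
    (forall n, (n0 <= n)%N ->
      (CLnorm vol +oo (f n)
        <= (c8 * expR (c9 * lambda n `^ alpha^-1))%:E)%E) ->
    forall S : R -> ('rV[R]_N -> R[i]) -> 'rV[R]_N -> R[i],
    is_semigroup vol HN S ->
    forall (g : 'rV[R]_N -> R[i]) (t : R), CLfun vol 2 g -> 0 < t <= 1 ->
      (CLnorm vol +oo (S t g)
        <= (C3 * expR (C4 * t `^ (- (alpha - 1)^-1)))%:E * CLnorm vol 2 g)%E].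

Proof.
(* The constants are fixed before any region or spectrum is introduced, hence depend only on c6, c7,
   c8, c9, n0 and alpha. *)
have [K [C4 [K0 C40 sumK]]] :=
  heat_sum_le c6_gt0 c7_gt0 c8_gt0 c9_gt0 n0_gt alpha_gt1.
exists (2 * K), C4; split=> //; first by rewrite mulr_gt0.
move=> N Omega rO vol HN l f _ l0 _ basisf eigf lge f_small f_large S semiS g t.
move=> L2g /andP[t0 _]; rewrite -mulrA.
pose b k := if (k < n0)%N then c8 else c8 * expR (c9 * l k `^ alpha^-1).
apply: (semigroup_eigenexpansion_Linfty (b := b) semiS basisf l0 eigf) => //.
- by move=> k; rewrite /b; case: ltnP; [exact: f_small|exact: f_large].
- by move=> n; exact: sumK.
- exact: ltW.
Qed.
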